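(* Let $a,b,c$ be nonnegative integers with $a+b\ge 1$ and $b+c\ge 1$. Then \[ P(GS_{a,b,c},1)=\frac{b}{(b+c+1)(b+c)}+\frac{b}{(a+b+1)(a+b)}, \] and for all nonnegative integers $a,b,c$, \[ P(GS_{a,b,c}^{+},1)=\frac{2b+c+2}{(b+c+1)(b+c+2)}+\frac{2b+a+2}{(b+a+1)(b+a+2)}-\frac{1}{a+2b+c+1}. \]
   Context: Forest building process: given a finite graph $G$ and a linear ordering of its edges, go through the edges in order and keep an edge if and only if at least one of its endpoints is not an endpoint of any earlier edge in the ordering (earlier edges count whether or not they were kept). The kept edges form a forest spanning the non-isolated vertices of $G$. $P(G,k)$ denotes the probability that, for a uniformly random ordering of the edges of $G$, the resulting forest has exactly $k$ trees (connected components). The glued-star graph $GS_{a,b,c}$ has two center vertices $u,w$, $a$ vertices adjacent only to $u$, $b$ vertices adjacent to both $u$ and $w$, and $c$ vertices adjacent only to $w$ (i.e., the stars $K_{1,a+b}$ and $K_{1,b+c}$ with $b$ of their leaves identified); it has $a+2b+c$ edges. $GS_{a,b,c}^{+}$ is $GS_{a,b,c}$ with the additional edge $uw$ joining the two centers. *)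

(* Defs.v *)
From HB Require Import structures.
From mathcomp Require Import all_boot all_order all_algebra.

Set Implicit Arguments.
Unset Strict Implicit.
Unset Printing Implicit Defensive.

Import GRing.Theory Num.Theory.

Local Open Scope ring_scope.

Record sgraph := SGraph {
  svertex :> finType;
  sedge : rel svertex;
  sedge_sym : symmetric sedge;
  sedge_irr : irreflexive sedge
}.

Definition edges (G : sgraph) : {set {set G}} :=
  [set [set p.1; p.2] | p : G * G & sedge p.1 p.2].

Definition edge_orderings (G : sgraph) : {set #|edges G|.-tuple {set G}} :=
  [set t : #|edges G|.-tuple {set G} | uniq t & [set:: t] == edges G].

(* [take (index e s) s] lists the edges before e, whether or not they were
   kept. *)
Definition kept (T : finType) (s : seq {set T}) : {set {set T}} :=
  [set e in s |
    [exists x in e, all (fun f : {set T} => x \notin f) (take (index e s) s)]].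

Definition kept_adj (T : finType) (s : seq {set T}) : rel T :=
  [rel x y | [set x; y] \in kept s].

(* The forest has vertex set [cover (kept s)], so isolated vertices of the
   graph are not counted as trees. *)
Definition num_trees (T : finType) (s : seq {set T}) : nat :=
  n_comp (kept_adj s) (cover (kept s)).

Definition forest_prob (G : sgraph) (k : nat) : rat :=
  #|[set t in edge_orderings G | num_trees t == k]|%:R
    / #|edge_orderings G|%:R.

Inductive GS_vertex (a b c : nat) : Type :=
  | center_u
  | center_w
  | leaf_u of 'I_a
  | shared_leaf of 'I_b
  | leaf_w of 'I_c.

Arguments center_u {a b c}.
Arguments center_w {a b c}.
Arguments leaf_u {a b c} _.
Arguments shared_leaf {a b c} _.
Arguments leaf_w {a b c} _.

Section GSFinType.

Variables a b c : nat.

Definition GS_encode (v : GS_vertex a b c) : bool + ('I_a + 'I_b + 'I_c) :=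
  match v with
  | center_u => inl true
  | center_w => inl false
  | leaf_u i => inr (inl (inl i))
  | shared_leaf i => inr (inl (inr i))
  | leaf_w i => inr (inr i)
  end.

Definition GS_decode (x : bool + ('I_a + 'I_b + 'I_c)) : GS_vertex a b c :=
  match x with
  | inl true => center_u
  | inl false => center_w
  | inr (inl (inl i)) => leaf_u i
  | inr (inl (inr i)) => shared_leaf i
  | inr (inr i) => leaf_w i
  end.

Lemma GS_encodeK : cancel GS_encode GS_decode.
Proof. by case. Qed.

HB.instance Definition _ := Finite.copy (GS_vertex a b c) (can_type GS_encodeK).

End GSFinType.

(* The boolean [uw] tells whether the edge between the centers is present. *)
Definition GS_arc (uw : bool) (a b c : nat) (x y : GS_vertex a b c) : bool :=
  match x, y with
  | center_u, leaf_u _ => true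
  | center_u, shared_leaf _ => true
  | center_w, shared_leaf _ => true
  | center_w, leaf_w _ => true
  | center_u, center_w => uw
  | _, _ => false
  end.

Definition GS_adj (uw : bool) (a b c : nat) : rel (GS_vertex a b c) :=
  [rel x y | GS_arc uw x y || GS_arc uw y x].

Lemma GS_adj_sym uw a b c : symmetric (@GS_adj uw a b c).
Proof. by move=> x y; rewrite /GS_adj /= orbC. Qed.

Lemma GS_adj_irr uw a b c : irreflexive (@GS_adj uw a b c).
Proof. by case. Qed.

Definition GS (a b c : nat) : sgraph :=
  SGraph (@GS_adj_sym false a b c) (@GS_adj_irr false a b c).

Definition GS_plus (a b c : nat) : sgraph :=
  SGraph (@GS_adj_sym true a b c) (@GS_adj_irr true a b c).

(* Main.v *)
Require Import Defs.
From mathcomp Require Import all_boot all_order all_algebra.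
From mathcomp Require Import fingroup perm.
From mathcomp Require Import zify ring.

(* Both centers have their first edge kept, and every other vertex keeps the
   first edge at it, so the forest has one tree iff the edge uw is kept or some
   shared leaf v keeps both its edges. The latter means that, for one center x
   with opposite center y, the first edge at x is xv and it comes after yv: a
   given v does this with probability 1 / (d (d + 1)), d the degree of x. The
   edge uw is kept iff it is the first edge at a center. The two resulting
   events, one per center, meet only when uw is the very first edge. *)

Set Implicit Arguments.
Unset Strict Implicit.
Unset Printing Implicit Defensive.

Import GRing.Theory Num.Theory.

Local Open Scope ring_scope.

(** * Uniformly random orderings of a finite set *)

Section RandomOrdering.

Variables (T : finType) (E : {set T}).
Implicit Types (A B Q : pred (seq T)) (F : {set T}) (f g : T) (s : seq T).

(** At [E := edges G] this is convertible to [edge_orderings G], so that [prob] covers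
    [forest_prob]. *)
Definition orderings : {set #|E|.-tuple T} :=
  [set t : #|E|.-tuple T | uniq t & [set:: t] == E].

Definition prob A : rat :=
  #|[set t in orderings | A t]|%:R / #|orderings|%:R.

Definition first_in F f s : bool :=
  [forall h in F, (index f s <= index h s)%N].

Lemma mem_orderings (t : #|E|.-tuple T) :
  t \in orderings -> (t : seq T) =i E.
Proof. by rewrite inE => /andP[_ /eqP/setP tE] x; rewrite -tE inE. Qed.

Lemma orderings_gt0 : (0 < #|orderings|)%N.
Proof.
apply/card_gt0P.
have sz : size (enum E) == #|E| by rewrite -cardE.
exists (Tuple sz); rewrite inE /= enum_uniq.
by apply/eqP/setP=> x; rewrite inE mem_enum.
Qed.

Lemma index_ordering_inj (t : #|E|.-tuple T) :
  t \in orderings -> {in E &, injective (index^~ t)}.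
Proof.
move=> tO f g fE gE; apply: index_inj => //; by rewrite mem_orderings.
Qed.

Lemma probE A :
  prob A = (\sum_(t in orderings) (A t)%:R) / #|orderings|%:R.
Proof.
rewrite /prob -sum1_card natr_sum; congr (_ / _).
rewrite [RHS](bigID (fun t => A (val t))) /= [X in _ + X]big1 ?addr0.
  by apply: eq_big => t; rewrite ?inE // => /andP[_ ->].
by move=> t /andP[_ /negbTE ->].
Qed.

Lemma eq_prob A B :
  (forall t : #|E|.-tuple T, t \in orderings -> A t = B t) ->
  prob A = prob B.
Proof.
by move=> eqAB; rewrite !probE; congr (_ / _); apply: eq_bigr => t /eqAB ->.
Qed.

Lemma prob_predT : prob predT = 1.
Proof.
rewrite probE sumr_const divff // pnatr_eq0 -lt0n; exact: orderings_gt0.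
Qed.

Lemma prob_or A B :
  prob (fun s => A s || B s) = prob A + prob B - prob (fun s => A s && B s).
Proof.
rewrite !probE -mulrDl -mulrBl -big_split -sumrB; congr (_ / _).
apply: eq_bigr => t _ /=.
by case: (A t); case: (B t); rewrite ?addrK ?subr0 ?addr0.
Qed.

Lemma prob_exists (I : finType) (P : pred I) (A : I -> pred (seq T)) :
  (forall (t : #|E|.-tuple T) i j, t \in orderings -> P i -> P j ->
     A i t -> A j t -> i = j) ->
  prob (fun s => [exists (i | P i), A i s]) = \sum_(i | P i) prob (A i).
Proof.
move=> uniqA; under eq_bigr do rewrite probE.
rewrite probE -mulr_suml exchange_big; congr (_ / _); apply: eq_bigr => t tO.
case: existsP => [[i /andP[Pi Ai]]|noA].
  rewrite (bigD1 i) //= Ai big1 ?addr0 // => j /andP[Pj neqji].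
  by case Aj: (A j t) => //; rewrite (uniqA t j i) ?eqxx in neqji.
rewrite big1 // => i Pi; case Ai: (A i t) => //.
by case: noA; exists i; rewrite Pi.
Qed.

(** Relabelling the entries by a permutation that preserves [E] is a bijection of the orderings. *)
Lemma prob_perm (sigma : {perm T}) A :
  (forall x, (sigma x \in E) = (x \in E)) ->
  prob (fun s => A (map sigma s)) = prob A.
Proof.
move=> sigmaE; rewrite /prob; congr (_%:R / _).
pose h (t : #|E|.-tuple T) := map_tuple sigma t.
have h_inj : injective h.
  by move=> t u /(congr1 val) /= /(inj_map perm_inj) /val_inj.
rewrite -[RHS](card_preimset _ h_inj); apply: eq_card => t.
rewrite !inE /= map_inj_uniq; last exact: perm_inj.
congr (_ && _ && _); apply/eqP/eqP => /setP Et; apply/setP => x.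
  rewrite -[x](permKV sigma) inE mem_map; last exact: perm_inj.
  by rewrite sigmaE -Et inE.
by rewrite -sigmaE -Et !inE mem_map //; exact: perm_inj.
Qed.

Lemma first_in_tperm F f g s :
  f \in F -> g \in F -> first_in F f (map (tperm f g) s) = first_in F g s.
Proof.
move=> fF gF.
have tF x : (tperm f g x \in F) = (x \in F).
  by case: tpermP => [->|->|]; rewrite ?fF ?gF.
have idx x : index x (map (tperm f g) s) = index (tperm f g x) s.
  by rewrite -{1}[x](tpermK f g) index_map //; exact: perm_inj.
apply/forall_inP/forall_inP => fst h hF.
  by have := fst (tperm f g h); rewrite tF !idx tpermL tpermK; apply.
by rewrite !idx tpermL; apply: fst; rewrite tF.
Qed.

(* The conditional probability, given [Q], that [f] comes first in [F] does not
   depend on [f], and these events partition [Q]. *)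
Lemma prob_first_in Q F f :
  F \subset E -> f \in F ->
  (forall g s, g \in F -> Q (map (tperm f g) s) = Q s) ->
  prob (fun s => Q s && first_in F f s) = prob Q / #|F|%:R.
Proof.
move=> /subsetP sFE fF invQ.
have F_neq0 : #|F|%:R != 0 :> rat.
  by rewrite pnatr_eq0 -lt0n; apply/card_gt0P; exists f.
apply: (canRL (mulfK F_neq0)); rewrite mulr_natr -sumr_const.
transitivity (\sum_(g in F) prob (fun s => Q s && first_in F g s)).
  apply: eq_bigr => g gF; rewrite -(@prob_perm (tperm f g)).
    by apply: eq_prob => t _ /=; rewrite invQ // first_in_tperm.
  by move=> x; case: tpermP => [->|->|]; rewrite ?(sFE f) ?(sFE g).
rewrite -prob_exists => [|t g h tO gF hF /andP[_ gfst] /andP[_ hfst]].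
  apply: eq_prob => t tO; apply/existsP/idP => [[g /and3P[] //]|Qt].
  (* The element of [F] of least position shows that the events cover [Q]. *)
  case: (arg_minnP (fun g => index g t) fF) => g gF gmin.
  by exists g; apply/and3P; split=> //; apply/forall_inP.
apply: (index_ordering_inj tO); rewrite ?sFE //; apply/eqP; rewrite eqn_leq.
by rewrite (forall_inP gfst) ?(forall_inP hfst).
Qed.

Lemma prob_first F f :
  F \subset E -> f \in F -> prob (first_in F f) = 1 / #|F|%:R.
Proof.
by move=> sFE fF; rewrite (@prob_first_in predT F f) // prob_predT.
Qed.

(** The event says that [g] heads [g |: F] and [f] heads [F]. The former has probability 1 / (|F| +
    1); given it, the latter has probability 1 / |F|, by symmetry within [F]. *)
Lemma prob_first_second F f g :
  F \subset E -> f \in F -> g \in E -> g \notin F ->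
  prob (fun s => first_in F f s && (index g s <= index f s)%N)
    = 1 / (#|F|%:R * #|F|.+1%:R).
Proof.
move=> sFE fF gE gF.
transitivity (prob (fun s => first_in (g |: F) g s && first_in F f s)).
  apply: eq_prob => t _; rewrite andbC; apply/andP/andP => -[gf ff]; split=> //.
    apply/forall_inP => h; rewrite !inE => /predU1P[-> //|hF].
    exact: leq_trans gf (forall_inP ff h hF).
  by apply: (forall_inP gf); rewrite !inE fF orbT.
rewrite prob_first_in // => [|h s hF].
  rewrite prob_first ?setU11 //; last by rewrite subUset sub1set gE.
  by rewrite cardsU1 gF add1n -mulrA -invfM [(#|F|.+1%:R * _)]mulrC.
(* A swap inside [F] fixes [g] and preserves [g |: F], hence also the event that [g] comes first
   there. *)
have tg : tperm f h g = g.
  by apply: tpermD; apply: contraNneq gF => <-.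
have idx x : index x (map (tperm f h) s) = index (tperm f h x) s.
  by rewrite -{1}[x](tpermK f h) index_map //; exact: perm_inj.
have tU x : (tperm f h x \in g |: F) = (x \in g |: F).
  by case: tpermP => [->|->|]; rewrite !inE ?fF ?hF ?orbT.
apply/forall_inP/forall_inP => fst x xU.
  by have := fst (tperm f h x); rewrite tU !idx tg tpermK; apply.
by rewrite !idx tg; apply: fst; rewrite tU.
Qed.

End RandomOrdering.

Lemma eq_set2 (T : finType) (x y z t : T) :
  [set x; y] = [set z; t] -> x = z /\ y = t \/ x = t /\ y = z.
Proof.
move=> e; have : x \in [set z; t] by rewrite -e set21.
have : y \in [set z; t] by rewrite -e set22.
have : z \in [set x; y] by rewrite e set21.
have : t \in [set x; y] by rewrite e set22.
rewrite !inE => /orP[]/eqP-> /orP[]/eqP-> /orP[]/eqP e1 /orP[]/eqP e2; subst;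
  by [left|right].
Qed.

Lemma set2_injr (T : finType) (x : T) : injective (fun y => [set x; y]).
Proof. by move=> y z /eq_set2[[_ ->]|[-> ->]]. Qed.

(** * Stars, kept edges and the number of trees in a general graph *)

Section Graph.

Variable G : sgraph.
Implicit Types (x y : G) (e : {set G}).

Definition star x : {set {set G}} := [set e in edges G | x \in e].

Lemma star_sub x : star x \subset edges G.
Proof. by apply/subsetP => e; rewrite inE => /andP[]. Qed.

Lemma edgesP e :
  reflect (exists x y, sedge x y /\ e = [set x; y]) (e \in edges G).
Proof.
apply: (iffP imsetP) => [[[x y]]|[x [y [xy ->]]]].
  by rewrite inE => xy ->; exists x, y.
by exists (x, y); rewrite ?inE.
Qed.

Lemma mem_edges x y : ([set x; y] \in edges G) = sedge x y.
Proof.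
apply/edgesP/idP => [[z [t [zt]]]|xy]; last by exists x, y.
by case/eq_set2 => -[-> ->] //; rewrite sedge_sym.
Qed.

Lemma starP x e :
  reflect (exists2 y, sedge x y & e = [set x; y]) (e \in star x).
Proof.
rewrite inE; apply: (iffP andP) => [[/edgesP[y [z [yz ->]]]]|[y xy ->]].
  rewrite !inE => /orP[/eqP->|/eqP->]; first by exists z.
  by exists y; rewrite 1?sedge_sym // setUC.
by rewrite mem_edges !inE eqxx.
Qed.

Lemma card_star x : #|star x| = #|[set y | sedge x y]|.
Proof.
rewrite -(card_imset _ (@set2_injr _ x)); apply: eq_card => e.
apply/starP/imsetP => [[y xy ->]|[y]]; first by exists y; rewrite ?inE.
by rewrite inE => xy ->; exists y.
Qed.

Section Ordering.

Variable t : #|edges G|.-tuple {set G}.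
Hypothesis tO : t \in edge_orderings G.

(** An endpoint [x] of [e] avoids all edges before [e] exactly when no edge at [x] has a smaller
    position. *)
Lemma mem_kept e :
  (e \in kept t) =
    (e \in edges G) && [exists x in e, first_in (star x) e t].
Proof.
have tE := mem_orderings tO.
rewrite inE tE; congr (_ && _); apply: eq_existsb => x; congr (_ && _).
apply/allP/forall_inP => fst f.
  rewrite inE => /andP[fE xf]; rewrite leqNgt -in_take ?tE //.
  by apply/negP => /fst; rewrite xf.
move=> ft; apply/negP => xf.
have fE : f \in edges G by rewrite -tE; exact: mem_take ft.
have := fst f; rewrite inE fE xf leqNgt -in_take ?tE // ft.
by move/(_ isT).
Qed.

Lemma kept_edge x y :
  ([set x; y] \in kept t) =
    sedge x y &&
      (first_in (star x) [set x; y] t || first_in (star y) [set x; y] t).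
Proof.
rewrite mem_kept mem_edges; congr (_ && _).
apply/existsP/orP => [[z /andP[]]|].
  by rewrite !inE => /orP[]/eqP ->; [left|right].
by case=> xy; [exists x|exists y]; rewrite !inE eqxx ?orbT.
Qed.

(** The earliest edge at a non-isolated vertex is kept. *)
Lemma star_cover x y : sedge x y -> x \in cover (kept t).
Proof.
move=> xy; have xyS : [set x; y] \in star x by apply/starP; exists y.
case: (arg_minnP (fun e => index e t) xyS) => e eS emin.
have [eE xe] : e \in edges G /\ x \in e.
  by have : e \in star x := eS; rewrite inE => /andP[].
apply/bigcupP; exists e => //; rewrite mem_kept eE.
by apply/existsP; exists x; rewrite xe; apply/forall_inP.
Qed.

(* Every tree contains [u] or [w], so there are at most two trees. *)
Lemma num_trees_eq1 (u w u' w' : G) :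
  (forall x y, sedge x y -> (x \in [set u; w]) || (y \in [set u; w])) ->
  u != w -> sedge u u' -> sedge w w' ->
  (num_trees t == 1%N) =
    ([set u; w] \in kept t)
    || [exists v, ([set u; v] \in kept t) && ([set w; v] \in kept t)].
Proof.
move=> uw_cover neq_uw uu' ww'; set K := kept_adj t.
have K_sym : connect_sym K.
  by apply: sym_connect_sym => x y; rewrite /K /kept_adj /= setUC.
have K_sedge x y : K x y -> sedge x y.
  by rewrite /K /kept_adj /= kept_edge => /andP[].
have cover_closed : closed K (cover (kept t)).
  apply: intro_closed => // x y Kxy _; apply/bigcupP.
  by exists [set x; y]; [exact: Kxy | rewrite set22].
(* With this, [n_comp_closure2] reduces the count to whether [u] and [w] are connected. *)
have coverE : cover (kept t) =i closure K (pred2 u w).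
  move=> v; apply/idP/idP.
    case/bigcupP=> e ke ve; have := ke.
    rewrite mem_kept => /andP[/edgesP[x [y [xy ee]]] _].
    have Kxy : K x y by rewrite /K /kept_adj /= -ee.
    have Kyx : K y x by rewrite /K /kept_adj /= setUC -ee.
    apply/pred0Pn; case/orP: (uw_cover _ _ xy); rewrite !inE => xuw.
      exists x; rewrite /= !inE xuw andbT.
      move: ve; rewrite ee !inE => /orP[]/eqP ->.
        exact: connect0.
      exact: connect1.
    exists y; rewrite /= !inE xuw andbT.
    move: ve; rewrite ee !inE => /orP[]/eqP ->; last exact: connect0.
    exact: connect1.
  (* The neighbours [u'] and [w'] ensure that [u] and [w] themselves lie in the forest. *)
  case/pred0Pn => x /andP[/= vx]; rewrite (closed_connect cover_closed vx).
  by case/orP => /eqP ->; apply: star_cover; eassumption.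
rewrite /num_trees (eq_n_comp_r coverE) n_comp_closure2 // eqSS eqb0 negbK.
apply/idP/orP => [uw|[Kuw|/existsP[v /andP[Kuv Kwv]]]]; first last.
- apply: (@connect_trans _ _ v); apply: connect1 => //.
  by rewrite /K /kept_adj /= setUC.
- exact: connect1.
case Kuw: ([set u; w] \in kept t); [by left|right].
apply: contraT => /existsPn noK.
(* Without a kept edge [uw] or a common kept neighbour, [u] and its kept neighbours form a closed
   set that misses [w]. *)
pose S := [pred x | (x == u) || ([set u; x] \in kept t)].
have SE x : (x \in S) = (x == u) || ([set u; x] \in kept t) by [].
have S_closed : closed K S.
  apply: intro_closed => // x y Kxy; rewrite !SE.
  have [eqxu _|/= neq_xu Kux] := eqVneq x u.
    by apply/orP; right; rewrite -eqxu; exact: Kxy.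
  have neq_xw : x != w by apply: contraFneq Kuw => <-.
  have := uw_cover _ _ (K_sedge _ _ Kxy).
  rewrite !in_set2 (negbTE neq_xu) (negbTE neq_xw) /=.
  case/orP => [->//|/eqP eyw].
  by case/andP: (noK x); split; [exact: Kux | rewrite -eyw setUC; exact: Kxy].
have := closed_connect S_closed uw; rewrite !SE eqxx Kuw.
by rewrite eq_sym (negbTE neq_uw).
Qed.

End Ordering.

End Graph.

(** * Glued stars: degrees, merging events and their probabilities *)

Section GluedStar.

Variables (uw : bool) (a b c : nat).

(** Treats both families at once: [GS] and [GS_plus] are convertible to the instances [false] and
    [true]. *)
Definition glued : sgraph :=
  SGraph (@GS_adj_sym uw a b c) (@GS_adj_irr uw a b c).

(** Indexing by a boolean makes [~~ k] the opposite center, so that each argument about one center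
    serves for both. *)
Definition center (k : bool) : glued := if k then center_u else center_w.

Definition spoke (k : bool) (i : 'I_b) : {set glued} :=
  [set center k; shared_leaf i : glued].

Definition axle : {set glued} := [set center true; center false].

(** The way in which the first edge at center [k] joins the two trees. The two spokes at a leaf are
    distinct edges, so in an ordering the weak inequality is strict. *)
Definition merges_at (k : bool) (s : seq {set glued}) : bool :=
  (uw && first_in (star (center k)) axle s)
  || [exists i, first_in (star (center k)) (spoke k i) s
                && (index (spoke (~~ k) i) s <= index (spoke k i) s)%N].

Lemma spoke_star k i : spoke k i \in star (center k).
Proof. by apply/starP; exists (shared_leaf i) => //; case: k. Qed.

Lemma spoke_edge k i : spoke k i \in edges glued.
Proof. exact: (subsetP (star_sub _)) (spoke_star k i). Qed.

Lemma mem_spoke k l i : (center k \in spoke l i) = (k == l).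
Proof. by rewrite !inE; case: k l => [] []. Qed.

Lemma spoke_inj k : injective (spoke k).
Proof. by move=> i j /set2_injr []. Qed.

Lemma spoke_neq k i : spoke (~~ k) i != spoke k i.
Proof.
by apply/eqP => e; have := mem_spoke k (~~ k) i; rewrite e mem_spoke; case: (k).
Qed.

Lemma spoke_notin_star k i : spoke (~~ k) i \notin star (center k).
Proof. by rewrite inE mem_spoke; case: (k); rewrite andbF. Qed.

Lemma axle_star k : (axle \in star (center k)) = uw.
Proof.
rewrite inE mem_edges -[sedge _ _]/(uw || false) orbF in_set2.
by case: k; rewrite eqxx ?orbT andbT.
Qed.

Lemma axle_edge : (axle \in edges glued) = uw.
Proof. by rewrite mem_edges -[sedge _ _]/(uw || false) orbF. Qed.

Lemma card_star_center k :
  #|star (center k)| = ((if k then a else c) + b + uw)%N.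
Proof.
rewrite card_star -sum1_card big_mkcond /=; under eq_bigr do rewrite inE.
(* Over the encoding type the sum splits by kind of vertex. *)
rewrite (reindex (@GS_decode a b c)) /=; last first.
  exists (@GS_encode a b c) => v _; last exact: GS_encodeK.
  by case: v => [[]|[[]|]].
rewrite !big_sumType big_bool /= /center.
by case: k; rewrite /= !sum_nat_const !card_ord /GS_adj /=;
  case: uw => /=; lia.
Qed.

Lemma center_incident (x y : glued) :
  sedge x y -> (x \in [set center true; center false])
    || (y \in [set center true; center false]).
Proof. by rewrite !inE; case: x; case: y. Qed.

Lemma star_shared i :
  star (shared_leaf i : glued) = [set spoke true i; spoke false i].
Proof.
apply/setP => e; apply/starP/set2P => [[[]//= _ ->]|].
- by left; rewrite setUC.
- by right; rewrite setUC.
by case=> ->; [exists (center true)|exists (center false)]; rewrite // setUC.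
Qed.

Lemma edges_glued : edges glued = star (center true) :|: star (center false).
Proof.
apply/setP => e; rewrite !inE -andb_orr andb_idr // => /edgesP[x [y [xy ->]]].
have := center_incident xy; rewrite !inE ![center _ == _]eq_sym.
by case/orP=> /orP[]->; rewrite ?orbT.
Qed.

(** The stars of the two centers cover all edges and share only the axle, when it is present. *)
Lemma card_edges_glued : #|edges glued| = (a + 2 * b + c + uw)%N.
Proof.
have : #|star (center true) :&: star (center false)| = uw.
  transitivity #|if uw then [set axle] else set0|; last first.
    by case: (uw); rewrite ?cards1 ?cards0.
  apply: eq_card => e; apply/setIP/idP => [[/starP[x ux ->]]|].
    rewrite inE => /andP[_]; rewrite in_set2.
    case/orP=> /eqP ex; rewrite -ex in ux *.
      by [].
    have uwT : uw by rewrite -[uw]orbF; exact: ux.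
    by rewrite uwT set11.
  case uwE: uw; last by rewrite inE.
  by move/set1P ->; rewrite !axle_star.
rewrite edges_glued cardsU !card_star_center => ->; case: (uw); lia.
Qed.

Section Ordering.

Variable t : #|edges glued|.-tuple {set glued}.
Hypothesis tO : t \in edge_orderings glued.

(** The second alternative is being first at the leaf, whose star consists of its two spokes. *)
Lemma kept_spoke k i :
  (spoke k i \in kept t) =
    first_in (star (center k)) (spoke k i) t
    || (index (spoke k i) t <= index (spoke (~~ k) i) t)%N.
Proof.
rewrite kept_edge // -mem_edges spoke_edge /=; congr (_ || _).
rewrite star_shared; apply/forall_inP/idP => [fst|le e].
  by apply: fst; rewrite !inE; case: (k); rewrite eqxx ?orbT.
by case/set2P=> ->; case: (k) le.
Qed.

Lemma kept_axle :
  (axle \in kept t) = uw && (first_in (star (center true)) axle t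
                             || first_in (star (center false)) axle t).
Proof. by rewrite kept_edge // -mem_edges axle_edge. Qed.

Lemma num_trees_glued (u' w' : glued) :
  sedge (center true) u' -> sedge (center false) w' ->
  (num_trees t == 1%N) = merges_at true t || merges_at false t.
Proof.
move=> uu' ww'.
rewrite (num_trees_eq1 tO center_incident _ uu' ww') // kept_axle.
(* Regroup by kind of link, axle or shared leaf, instead of by center. *)
rewrite /merges_at orbACA -andb_orr; congr (_ || _).
(* The earlier spoke is kept because of the leaf, so the later one must be first at its center. *)
have both i : (spoke true i \in kept t) && (spoke false i \in kept t) =
    first_in (star (center true)) (spoke true i) t
      && (index (spoke false i) t <= index (spoke true i) t)%N
    || first_in (star (center false)) (spoke false i) t
      && (index (spoke true i) t <= index (spoke false i) t)%N.
  rewrite !kept_spoke /=.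
  have neq : index (spoke false i) t != index (spoke true i) t.
    apply: contra (spoke_neq true i) => /eqP /(index_ordering_inj tO) -> //;
      exact: spoke_edge.
  case: (ltngtP (index (spoke false i) t)) neq => // _ _.
    by rewrite orbT orbF andbT andbF orbF.
  by rewrite orbT orbF andbT andbF.
apply/existsP/orP => [[v /andP[Kuv Kwv]]|].
  (* Only shared leaves are adjacent to both centers. *)
  have [uv wv] : sedge (center true) v /\ sedge (center false) v.
    by move: Kuv Kwv; rewrite !kept_edge // => /andP[-> _] /andP[-> _].
  case: v uv wv Kuv Kwv => //= i _ _ Ku Kw.
  have := both i; rewrite {1}/spoke Ku {1}/spoke Kw => /esym.
  by case/orP => H; [left|right]; apply/existsP; exists i.
by case=> /existsP[i H]; exists (shared_leaf i : glued);
  rewrite [_ && _]both H ?orbT.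
Qed.

Lemma first_center_inj k e f :
  e \in star (center k) -> f \in star (center k) ->
  first_in (star (center k)) e t -> first_in (star (center k)) f t -> e = f.
Proof.
move=> eS fS efst ffst.
apply: (index_ordering_inj tO); rewrite ?(subsetP (star_sub (center k))) //.
by apply/eqP; rewrite eqn_leq (forall_inP efst) ?(forall_inP ffst).
Qed.

Lemma axle_neq_spoke k i : axle != spoke k i.
Proof.
apply/eqP => e; have := mem_spoke (~~ k) k i; rewrite -e !inE.
by case: (k).
Qed.

(* Both conditions can only hold through the edge joining the centers: else the
   first edges at the two centers would each be preceded by an edge at the
   other center. *)
Lemma merges_at_both :
  merges_at true t && merges_at false t = uw && first_in (edges glued) axle t.
Proof.
have lt k i : (index (spoke (~~ k) i) t <= index (spoke k i) t)%N ->
    (index (spoke (~~ k) i) t < index (spoke k i) t)%N.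
  rewrite leq_eqVlt => /predU1P[] // /(index_ordering_inj tO) e.
  by have := spoke_neq k i; rewrite e ?eqxx // spoke_edge.
have axleS k : uw -> axle \in star (center k) by rewrite axle_star.
apply/andP/andP => [[]|[uwT fst]]; last first.
  by split; apply/orP; left; rewrite uwT; apply/forall_inP => f fS;
    apply: (forall_inP fst); apply: (subsetP (star_sub _)) fS.
case/orP => [/andP[uwT fu]|/existsP[i /andP[fu /(lt true) iu]]];
  case/orP => [/andP[uwT' fw]|/existsP[j /andP[fw /(lt false) jw]]].
- split=> //; apply/forall_inP => f fE.
  have /setUP[fS|fS] : f \in star (center true) :|: star (center false).
      by rewrite -edges_glued.
    exact: (forall_inP fu).
  exact: (forall_inP fw).
(* In this and the remaining cases the comparisons of positions close up into a cycle with a strict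
   step. *)
- have := leq_trans (leq_trans jw (forall_inP fw _ (axleS _ uwT)))
    (forall_inP fu _ (spoke_star true j)).
  by rewrite ltnn.
- have := leq_trans (leq_trans iu (forall_inP fu _ (axleS _ uwT')))
    (forall_inP fw _ (spoke_star false i)).
  by rewrite ltnn.
have := leq_trans (leq_trans iu (forall_inP fu _ (spoke_star true j)))
  (leq_trans (ltnW jw) (forall_inP fw _ (spoke_star false i))).
by rewrite ltnn.
Qed.

End Ordering.

(** The axle, if present, is first at the center with probability 1 / m, and each of the [b] shared
    leaves contributes 1 / (m (m + 1)). These events are disjoint, since only one edge is first at a
    center. *)
Lemma prob_merges_at k (m := #|star (center k)|) :
  prob (edges glued) (merges_at k)
    = uw%:R / m%:R + b%:R / (m%:R * m.+1%:R).
Proof.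
(* The subtracted zero is the probability that the axle and a spoke are both first. *)
rewrite prob_or -[RHS]subr0; congr (_ + _ - _).
- case: (boolP uw) => uwT; last by rewrite mul0r probE big1 ?mul0r.
  by rewrite (@prob_first _ _ _ axle) ?star_sub ?axle_star.
- rewrite (@prob_exists _ _ _ predT) => [|t i j tO _ _ /andP[fi _] /andP[fj _]].
    under eq_bigr do rewrite prob_first_second ?star_sub ?spoke_star ?spoke_edge
      ?spoke_notin_star //.
    rewrite sumr_const card_ord mul1r; exact/esym/mulr_natl.
  apply: (@spoke_inj k); apply: first_center_inj fi fj => //; exact: spoke_star.
rewrite probE big1 ?mul0r // => t tO; apply/eqP; rewrite pnatr_eq0 eqb0.
apply/negP => /andP[/andP[uwT fu] /existsP[i /andP[fi _]]].
have := axle_neq_spoke k i; rewrite (first_center_inj tO _ _ fu fi) ?eqxx //.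
  by rewrite axle_star.
exact: spoke_star.
Qed.

(** Inclusion-exclusion over the two centers; the overlap is that the axle is the first of all
    edges. *)
Lemma forest_prob_glued (u' w' : glued) :
  sedge (center true) u' -> sedge (center false) w' ->
  forest_prob glued 1 =
    prob (edges glued) (merges_at true) + prob (edges glued) (merges_at false)
    - uw%:R / (a + 2 * b + c + uw)%:R.
Proof.
move=> uu' ww'.
transitivity (prob (edges glued) (fun s => merges_at true s || merges_at false s)).
  apply: (@eq_prob _ (edges glued) (fun s => num_trees s == 1%N)) => t tO.
  by rewrite (num_trees_glued tO uu' ww').
rewrite (@prob_or _ _ (merges_at true) (merges_at false)) -card_edges_glued.
congr (_ - _).
transitivity
  (prob (edges glued) (fun s => uw && first_in (edges glued) axle s)).
  by apply: eq_prob => t tO; exact: merges_at_both.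
case: (boolP uw) => uwT /=; last by rewrite mul0r probE big1 ?mul0r.
by rewrite prob_first ?axle_edge.
Qed.

End GluedStar.

(** * Evaluation of the two formulas *)

Theorem theorem3 (a b c : nat) :
  ((1 <= a + b)%N -> (1 <= b + c)%N ->
     forest_prob (GS a b c) 1 =
       b%:R / ((b + c + 1) * (b + c))%N%:R
       + b%:R / ((a + b + 1) * (a + b))%N%:R)
  /\
  forest_prob (GS_plus a b c) 1 =
    (2 * b + c + 2)%N%:R / ((b + c + 1) * (b + c + 2))%N%:R
    + (2 * b + a + 2)%N%:R / ((b + a + 1) * (b + a + 2))%N%:R
    - 1 / (a + 2 * b + c + 1)%N%:R.
Proof.
split=> [ab bc|].
  (* The bounds give each center a neighbour: a shared leaf when it has no leaf of its own. *)
  have nbr k : exists v, @sedge (glued false a b c) (center _ _ _ _ k) v.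
    case: k; [case: a ab => [|n _] | case: c bc => [|n _]].
    - by case: b bc => // n _ _; exists (shared_leaf ord0).
    - by exists (leaf_u ord0).
    - by rewrite addn0; case: b ab => // n _ _; exists (shared_leaf ord0).
    - by exists (leaf_w ord0).
  have [[u' uu'] [w' ww']] := (nbr true, nbr false).
  rewrite -[GS a b c]/(glued false a b c) (forest_prob_glued uu' ww').
  (* The statement puts the term of [w] first, hence [addrC]. *)
  rewrite !prob_merges_at !card_star_center /= !mul0r !add0r subr0 addrC.
  by rewrite !addn0 !addn1 -!natrM [(c + b)%N]addnC ![(_ * _.+1)%N]mulnC.
(* The share of a center with [n] leaves of its own: for d = n + b + 1 it is 1 / d + b / (d (d + 1))
   = (d + 1 + b) / (d (d + 1)). *)
have half n : 1 / (n + b + 1)%:R + b%:R / ((n + b + 1)%:R * (n + b + 1).+1%:R)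
    = (2 * b + n + 2)%N%:R / ((b + n + 1) * (b + n + 2))%N%:R :> rat.
  have pos1 : (n + b + 1)%:R != 0 :> rat by rewrite pnatr_eq0 addn1.
  have pos2 : (n + b + 2)%:R != 0 :> rat by rewrite pnatr_eq0 addn2.
  rewrite [(b + n)%N]addnC -[(n + b + 1).+1]addnS natrM.
  by rewrite !natrD in pos1 pos2 *; field; rewrite pos1 pos2.
rewrite -[GS_plus a b c]/(glued true a b c).
(* Each center serves as the neighbour of the other. *)
rewrite (@forest_prob_glued true a b c center_w center_u) //.
by rewrite !prob_merges_at !card_star_center /= !half [X in X - _]addrC.
Qed.
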